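(* Let $l,m,n$ be nonnegative integers. Then $$\sum_{k=0}^l(-1)^{m-k}\binom{l}{k}\binom{m-k}{n}\binom{2k}{k-2l+m} =\sum_{k=0}^l\binom lk\binom{2k}n\binom{n-l}{m+n-3k-l}.$$
   Context: For any (real or complex) number $x$ and integer $k$, the binomial coefficient is defined by $\binom xk=\frac1{k!}\prod_{j=0}^{k-1}(x-j)$ if $k>0$, $\binom x0=1$, and $\binom xk=0$ if $k<0$. In particular the upper argument may be negative (e.g. $n-l<0$). *)

(* Defs.v *)
From HB Require Import structures.
From mathcomp Require Import all_boot all_order all_algebra.

Set Implicit Arguments.
Unset Strict Implicit.
Unset Printing Implicit Defensive.

Import Order.TTheory GRing.Theory Num.Theory.
Local Open Scope ring_scope.

(* Generalized binomial coefficient; for k = 0 the empty product gives 1, and *)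
(* Negz covers exactly the integers k < 0.                                    *)
Definition gbinom (F : numFieldType) (x : F) (k : int) : F :=
  match k with
  | Posz n => (n`!)%:R^-1 * \prod_(0 <= j < n) (x - j%:R)
  | Negz _ => 0
  end.

(* Main.v *)
Require Import Defs.
From HB Require Import structures.
From mathcomp Require Import all_boot all_order all_algebra.
From mathcomp Require Import zify ring.

Set Implicit Arguments.
Unset Strict Implicit.
Unset Printing Implicit Defensive.

Import Order.TTheory GRing.Theory Num.Theory.
Local Open Scope ring_scope.

(** Both sides are the coefficient of [x^m y^n] in [(x W)^l], where
    [W = 1 - x + x y^2 + x^2 (1 + y)^2].  The left-hand side comes from
    [W = x z^2 + (1 - x z)^2] with [z = 1 + y], the right-hand side from
    [(1 + x) W = 1 + x (x + y (1 + x))^2].  The division by [(1 + x)^l] in the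
    latter is where binomials with upper argument [n - l] come from; it is
    carried out on coefficients, by Pascal's rule, so that no power series are
    needed. *)

Section GeneralizedBinomial.

Variable F : numFieldType.
Implicit Type x : F.

Lemma gbinom_nat (a k : nat) : gbinom (a%:R : F) k%:Z = 'C(a, k)%:R.
Proof.
have ffactE : \prod_(0 <= j < k) (a%:R - j%:R : F) = (a ^_ k)%:R.
  elim: k => [|k IHk]; first by rewrite big_geq.
  rewrite big_nat_recr //= IHk ffactnSr natrM.
  have [le_ka|lt_ak] := leqP k a; first by rewrite natrB.
  by rewrite ffact_small // !mul0r.
have fact_neq0 : (k`!)%:R != 0 :> F by rewrite pnatr_eq0 -lt0n fact_gt0.
by rewrite /= ffactE -bin_ffact natrM mulrC mulfK.
Qed.

Lemma gbinom_pascal x (k : int) :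
  gbinom (x + 1) k = gbinom x k + gbinom x (k - 1).
Proof.
case: k => [[|k]|k]; [by rewrite /= !big_geq ?addr0 | | by rewrite /= addr0].
have -> : k.+1%:Z - 1 = k%:Z by lia.
(* Since [(x + 1) - (j + 1) = x - j], peeling the first factor on the left and the last one on the
   right leaves the same product on both sides. *)
rewrite /= big_nat_recl // big_nat_recr //= subr0.
under eq_bigr => j _ do rewrite -natr1 opprD addrACA subrr addr0.
have fact_neq0 : (k`!)%:R != 0 :> F by rewrite pnatr_eq0 -lt0n fact_gt0.
have k1_neq0 : k%:R + 1 != 0 :> F by rewrite natr1 pnatr_eq0.
rewrite factS natrM -natr1.
by field; rewrite fact_neq0.
Qed.

End GeneralizedBinomial.

Section PolynomialCoefficients.

Lemma coef_linear_exp (R : comNzRingType) (a b : R) (N n : nat) :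
  ((a%:P + b%:P * 'X) ^+ N)`_n = a ^+ (N - n) * b ^+ n *+ 'C(N, n).
Proof.
have coef_term (i : nat) : (a%:P ^+ (N - i) * (b%:P * 'X) ^+ i *+ 'C(N, i))`_n
    = (a ^+ (N - n) * b ^+ n *+ 'C(N, n)) *+ (n == i).
  rewrite coefMn exprMn -!polyC_exp !coefCM coefXn.
  by case: eqP => [<-|_]; rewrite ?mulr1 // !mulr0 mul0rn.
rewrite exprDn coef_sum; under eq_bigr => i _ do rewrite coef_term.
have [lt_Nn|le_nN] := ltnP N n.
  by rewrite bin_small // big1 // => i _; rewrite mul0rn.
have lt_nN1 : (n < N.+1)%N by [].
rewrite (bigD1 (Ordinal lt_nN1)) //= eqxx big1 ?addr0 // => i.
by rewrite -val_eqE /= eq_sym => /negPf ->.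
Qed.

Lemma coef_XD1n (R : comNzRingType) (a n : nat) :
  (('X + 1 : {poly R}) ^+ a)`_n = 'C(a, n)%:R.
Proof.
have -> : 'X + 1 = 1%:P + 1%:P * 'X :> {poly R} by rewrite mul1r addrC.
by rewrite coef_linear_exp !expr1n mulr1.
Qed.

Variables (F : numFieldType) (I : finType) (c : I -> F) (e : I -> nat).

(** Formally, the coefficient of [X^m] in the sum of the [c i X^(e i)], times [(1 + X)^x]. *)
Let T (x : F) (m : int) := \sum_i c i * gbinom x (m - (e i)%:Z).

Let T_pascal (x : F) (m : int) : T (x + 1) m = T x m + T x (m - 1).
Proof.
rewrite -big_split; apply: eq_bigr => i _ /=.
by rewrite gbinom_pascal mulrDr (addrAC m).
Qed.

Let T_nat (n m : nat) :
  ((\sum_i c i *: 'X^(e i)) * ('X + 1) ^+ n)`_m = T n%:R m%:Z.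
Proof.
rewrite mulr_suml coef_sum; apply: eq_bigr => i _.
rewrite -scalerAl coefZ coefXnM coef_XD1n; congr (_ * _).
case: ltnP => [lt_me|le_em]; last by rewrite subzn // gbinom_nat.
by have -> : m%:Z - (e i)%:Z = Negz (e i - m).-1 by lia.
Qed.

(** Removing one factor [X + 1] lowers the first argument of [T] by one: the coefficients of [A] and
    the values of [T] obey the same Pascal recurrence, which determines the entry at [m + 1] from
    the one at [m]. *)
Lemma coef_XD1n_quotient (A : {poly F}) (l n m : nat) :
    ('X + 1) ^+ l * A = (\sum_i c i *: 'X^(e i)) * ('X + 1) ^+ n ->
  A`_m = \sum_i c i * gbinom (n%:R - l%:R) (m%:Z - (e i)%:Z).
Proof.
rewrite -[X in _ -> _ = X]/(T _ _); elim: l A m => [|l IHl] A m.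
  by rewrite expr0 mul1r subr0 => ->; exact: T_nat.
rewrite exprSr -mulrA => /IHl coefB.
have eq_x : n%:R - l%:R = n%:R - l.+1%:R + 1 :> F by rewrite -natr1; ring.
elim: m => [|m IHm]; have := coefB; rewrite eq_x.
  move/(_ 0); rewrite T_pascal mulrDl mul1r coefD coefXM eqxx add0r => ->.
  (* The recurrence starts because every lower index in [T _ (-1)] is negative. *)
  rewrite [X in _ + X]big1 ?addr0 // => i _.
  have -> : 0%:Z - 1 - (e i)%:Z = Negz (e i) by lia.
  exact: mulr0.
move/(_ m.+1); rewrite T_pascal mulrDl mul1r coefD coefXM /= IHm addrC.
have -> : m.+1%:Z - 1 = m%:Z by lia.
exact: addIr.
Qed.

End PolynomialCoefficients.

Section GeneratingFunction.

Variable F : numFieldType.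

(* The outer variable of [{poly {poly F}}] is [y], the inner one is [x]. *)
Let x : {poly {poly F}} := ('X)%:P.
Let y : {poly {poly F}} := 'X.

Definition genpoly : {poly {poly F}} :=
  x * (1 - x + x * y ^+ 2 + x ^+ 2 * (y + 1) ^+ 2).

Let coef_monomial (s : F) (e a n m N : nat) :
  (((s *: 'X^e)%:P * (y + 1) ^+ a) *+ N)`_n`_m
    = N%:R * (s * 'C(a, n)%:R * (m == e)%:R).
Proof.
rewrite coefMn coefMn coefCM coef_XD1n -scalerAl coefZ -polyC_natr coefMC.
by rewrite coefXn -[LHS]mulr_natl; ring.
Qed.

(** With [z = y + 1], [genpoly] is [(x z)^2 + x (1 - x z)^2]. Here [k] counts the choices of the
    second summand, and [i] the factors [- x z] taken from [(1 - x z)^(2 k)]. *)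
Lemma coef_genpoly_expl (l n m : nat) :
  (genpoly ^+ l)`_n`_m =
  \sum_(k < l.+1) 'C(l, k)%:R * \sum_(i < (2 * k).+1) 'C(2 * k, i)%:R *
    ((-1) ^+ i * 'C(2 * (l - k) + i, n)%:R * (m == 2 * (l - k) + k + i)%N%:R).
Proof.
have -> : genpoly = x ^+ 2 * (y + 1) ^+ 2 + x * (1 - x * (y + 1)) ^+ 2.
  by rewrite /genpoly; ring.
rewrite exprDn !coef_sum; apply: eq_bigr => k _.
rewrite !coefMn -[LHS]mulr_natl; congr (_ * _).
rewrite [X in _ * X]exprMn -exprM exprBn !mulr_sumr !coef_sum.
apply: eq_bigr => i _; rewrite expr1n mulr1 -coef_monomial.
apply: (congr1 (fun p : {poly {poly F}} => p`_n`_m)).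
rewrite !mulrnAr; congr (_ *+ _).
rewrite -mul_polyC polyCM !polyC_exp !polyCN -/x !exprMn !exprD.
by ring.
Qed.

Lemma coef_genpoly_quotient (l n : nat) :
  ('X + 1) ^+ l * (genpoly ^+ l)`_n =
  (\sum_(k < l.+1) ('C(l, k)%:R * 'C(2 * k, n)%:R) *: 'X^(3 * k + l - n))
    * ('X + 1) ^+ n.
Proof.
rewrite -coefCM polyC_exp polyCD -/x -exprMn.
have -> : (x + 1%:P) * genpoly = x + x ^+ 2 * (x + ('X + 1)%:P * y) ^+ 2.
  by rewrite /genpoly polyCD -/x; ring.
rewrite exprDn coef_sum mulr_suml; apply: eq_bigr => k _.
rewrite coefMn -scalerA -scalerAl scaler_nat; congr (_ *+ _).
rewrite -scalerAl scaler_nat.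
rewrite exprMn -!exprM mulrA -exprD -polyC_exp coefCM coef_linear_exp.
(* The truncated subtraction in [3 * k + l - n] is harmless: the term vanishes unless
   [n <= 2 * k]. *)
have [lt_kn|le_nk] := ltnP (2 * k) n; first by rewrite bin_small ?mulr0.
rewrite mulrnAr mulrA -exprD; congr ('X^_ * _ *+ _).
by have := ltn_ord k; lia.
Qed.

End GeneratingFunction.

Theorem theorem1p1 (F : numFieldType) (l m n : nat) :
  \sum_(0 <= k < l.+1)
     (-1) ^ (m%:Z - k%:Z) * gbinom (l%:R : F) k%:Z
       * gbinom (m%:R - k%:R : F) n%:Z
       * gbinom ((2 * k)%:R : F) (k%:Z - 2 * l%:Z + m%:Z)
  = \sum_(0 <= k < l.+1)
     gbinom (l%:R : F) k%:Z * gbinom ((2 * k)%:R : F) n%:Z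
       * gbinom (n%:R - l%:R : F) (m%:Z + n%:Z - 3 * k%:Z - l%:Z).
Proof.
rewrite !big_mkord; transitivity ((genpoly F ^+ l)`_n`_m); last first.
  rewrite (coef_XD1n_quotient m (coef_genpoly_quotient F l n)).
  apply: eq_bigr => k _; rewrite !gbinom_nat.
  have [lt_kn|le_nk] := ltnP (2 * k) n.
    by rewrite (bin_small lt_kn) mulr0 !mul0r.
  by congr (_ * gbinom _ _); have := ltn_ord k; lia.
rewrite coef_genpoly_expl; apply: eq_bigr => k _.
have le_kl : (k <= l)%N by have := ltn_ord k; lia.
rewrite [gbinom l%:R _]gbinom_nat [_ * 'C(l, k)%:R]mulrC -2!mulrA.
congr (_ * _).
have [lt_mk|le_mk] := ltnP (m + k) (2 * l).
  have -> : k%:Z - 2 * l%:Z + m%:Z = Negz (2 * l - (m + k)).-1 by lia.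
  rewrite !mulr0 big1 // => i _; case: eqP => [|_]; last by rewrite !mulr0.
  by lia.
(* [d] is the only [i] that can pass the test on the power of [x]. As [k <= l], the present case
   also forces [k <= m], so [m - k] is a natural number, with the parity of [d]. *)
set d := (m + k - 2 * l)%N.
have -> : k%:Z - 2 * l%:Z + m%:Z = d%:Z by lia.
have mkE : (m - k = 2 * (l - k) + d)%N by lia.
have le_km : (k <= m)%N by lia.
rewrite -natrB // subzn // -exprnP !gbinom_nat mkE.
(* If [d] exceeds the range of [i], the inner sum is zero, and so is the binomial ['C(2 * k, d)]. *)
have [lt_kd|le_dk] := ltnP (2 * k) d.
  rewrite (bin_small lt_kd) !mulr0 big1 // => i _.
  case: eqP => [|_]; last by rewrite !mulr0.
  by have := ltn_ord i; lia.
have lt_dk1 : (d < (2 * k).+1)%N by [].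
rewrite (bigD1 (Ordinal lt_dk1)) //= big1 ?addr0 => [|i].
  have -> : (m == 2 * (l - k) + k + d)%N by lia.
  by rewrite exprD exprM sqrrN !expr1n mul1r mulr1; ring.
rewrite -val_eqE /= => neq_id; case: eqP => [|_]; last by rewrite !mulr0.
by lia.
Qed.
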